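(* Let $G$ be a connected graph with maximum degree $\Delta(G)$, and let $\pi$ be an $ic$-partition of $G$. If $X\in\pi$, then $X$ is in at most $\Delta(G)$ independent coalitions (that is, there are at most $\Delta(G)$ sets $Y\in\pi$ such that $X$ and $Y$ form an independent coalition). Furthermore, this bound is sharp, i.e. there exist a connected graph $G$, an $ic$-partition $\pi$ of $G$ and a set $X\in\pi$ such that $X$ forms an independent coalition with exactly $\Delta(G)$ sets of $\pi$.
   Context: Graphs are finite and simple. A set $S$ of vertices is dominating if every vertex is in $S$ or adjacent to a vertex of $S$; it is independent if its vertices are pairwise nonadjacent; an independent dominating set is a set that is both independent and dominating. An independent coalition in $G$ consists of two disjoint independent sets of vertices $V_1,V_2$, neither of which is an independent dominating set but whose union $V_1\cup V_2$ is an independent dominating set; one says that $V_1$ and $V_2$ form an independent coalition. An $ic$-partition of $G$ is a partition $\pi=\{V_1,\dots,V_k\}$ of $V(G)$ into nonempty sets such that every $V_i\in\pi$ either is a singleton dominating set (a dominating set of cardinality 1), or is not an independent dominating set but forms an independent coalition with another set $V_j\in\pi$. *)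

(* Defs.v *)
From mathcomp Require Import all_boot.

Set Implicit Arguments.
Unset Strict Implicit.
Unset Printing Implicit Defensive.

Record sgraph := SGraph {
  vertex :> finType;
  adj : rel vertex;
  adj_sym : symmetric adj;
  adj_irrefl : irreflexive adj
}.

Section IndependentCoalitions.
Variable G : sgraph.
Implicit Types (S X Y : {set G}) (P : {set {set G}}).

Definition connected_graph : bool :=
  (0 < #|G|) && [forall x : G, forall y : G, connect (@adj G) x y].

Definition nbhd (x : G) : {set G} := [set y | adj x y].

Definition max_degree : nat := \max_(x : G) #|nbhd x|.

Definition dominating S : bool :=
  [forall x : G, (x \in S) || [exists y in S, adj x y]].

Definition independent S : bool :=
  [forall x in S, forall y in S, ~~ adj x y].

Definition ind_dominating S : bool := independent S && dominating S.

Definition ind_coalition X Y : bool :=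
  [&& [disjoint X & Y], independent X, independent Y,
      ~~ ind_dominating X, ~~ ind_dominating Y & ind_dominating (X :|: Y)].

(* [partition] already excludes empty blocks. *)
Definition ic_partition P : bool :=
  partition P [set: G] &&
  [forall X in P,
     ((#|X| == 1) && dominating X)
     || (~~ ind_dominating X
         && [exists Y in P, (Y != X) && ind_coalition X Y])].

Definition coalition_partners P X : {set {set G}} :=
  [set Y in P | ind_coalition X Y].

End IndependentCoalitions.

Arguments connected_graph G : clear implicits.
Arguments max_degree G : clear implicits.

(* Main.v *)
Require Import Defs.
From mathcomp Require Import all_boot.

(** Let [X] be a block and let [Y1, ..., Yk] be its partners.  Each [X :|: Yi]
    is independent, so no vertex of a partner has a neighbour in [X].  Each
    [X :|: Yj] is dominating, so a vertex [u] of [Yi] must therefore have a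
    neighbour in every other partner [Yj].  The partners being disjoint, [u] has
    at least [k - 1] neighbours in the union [C] of the partners
    ([partners_leq_nbhd]).  If [k] exceeded the maximum degree, these would be
    all the neighbours of [u]: the nonempty set [C] would be closed under
    adjacency and, by connectedness, be the whole vertex set
    ([connected_closedT]).  But [C] misses the nonempty block [X].

    For sharpness, consider the path on four vertices partitioned into
    singletons.  Two singletons form an independent coalition exactly when the
    vertices are distinct and nonadjacent, so an end of the path has two
    partners, and two is the maximum degree. *)

Section Bound.
Variable G : sgraph.
Implicit Types (X Y : {set G}) (P : {set {set G}}).

Lemma connected_closedT (C : {set G}) (u : G) :
  connected_graph G -> u \in C ->
  (forall x, x \in C -> nbhd x \subset C) -> C = [set: G].
Proof.
case/andP=> _ /forallP conG uC closedC; apply/setP=> z; rewrite inE.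
have /connectP[p] := forallP (conG u) z.
elim: p u uC => [|y p IHp] u uC /=; first by move=> _ ->.
case/andP=> uy; apply: IHp.
by apply: (subsetP (closedC u uC)); rewrite inE.
Qed.

(** [X :|: Y] gives [u] no neighbour in [X], so the domination of [u] by
    [X :|: Z] can only come from [Z]. *)
Lemma coalition_nbhd_meets {X Y Z} {u : G} :
  ind_coalition X Y -> ind_coalition X Z -> u \in Y -> u \notin Z ->
  exists2 w, w \in Z & adj u w.
Proof.
case/and5P=> disXY _ _ _ /andP[_ /andP[indXY _]].
case/and5P=> _ _ _ _ /andP[_ /andP[_ /forallP /(_ u)]] domu uY uZ.
have uX : u \notin X by rewrite (disjointFl disXY uY).
move: domu; rewrite inE (negPf uX) (negPf uZ) /= => /existsP[w].
rewrite inE => /andP[/orP[wX|wZ] uw]; last by exists w.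
have uXY : u \in X :|: Y by rewrite inE uY orbT.
have wXY : w \in X :|: Y by rewrite inE wX.
move/forallP/(_ u)/implyP/(_ uXY)/forallP/(_ w)/implyP/(_ wXY): indXY.
by rewrite uw.
Qed.

(** Sending a neighbour of [u] to its block covers every partner other than
    the one containing [u]. *)
Lemma partners_leq_nbhd P X Y (u : G) :
  partition P [set: G] -> Y \in coalition_partners P X -> u \in Y ->
  #|coalition_partners P X| <= #|nbhd u :&: cover (coalition_partners P X)|.+1.
Proof.
move=> /and3P[_ trivP _] YQ uY; set Q := coalition_partners P X.
have /andP[YP cXY] : (Y \in P) && ind_coalition X Y by rewrite inE in YQ.
rewrite (cardsD1 Y) YQ add1n ltnS.
apply: leq_trans (leq_imset_card (pblock P) _); apply: subset_leq_card.
apply/subsetP=> Z /setD1P[ZY ZQ].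
have /andP[ZP cXZ] : (Z \in P) && ind_coalition X Z by rewrite inE in ZQ.
have uZ : u \notin Z.
  apply: contra ZY => uZ.
  by rewrite -(def_pblock trivP ZP uZ) (def_pblock trivP YP uY).
have [w wZ uw] := coalition_nbhd_meets cXY cXZ uY uZ.
apply/imsetP; exists w; last by rewrite (def_pblock trivP ZP wZ).
by rewrite !inE uw; apply/bigcupP; exists Z.
Qed.

Lemma partners_leq_max_degree P X :
  connected_graph G -> partition P [set: G] -> X \in P ->
  #|coalition_partners P X| <= max_degree G.
Proof.
move=> conG partP XP; rewrite leqNgt; apply/negP=> bigQ.
set Q := coalition_partners P X in bigQ.
have P0 : set0 \notin P by case/and3P: partP.
(* With more partners than the maximum degree, the neighbours of a vertex of a
   partner that lie in [cover Q] are as many as all its neighbours. *)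
have closedQ x : x \in cover Q -> nbhd x \subset cover Q.
  case/bigcupP=> Y YQ xY; apply/setIidPl/eqP.
  rewrite eqEcard subsetIl /=.
  apply: leq_trans (leq_bigmax (F := fun x : G => #|nbhd x|) x) _.
  by rewrite -ltnS; apply: leq_trans bigQ (partners_leq_nbhd _ _ _ _ partP YQ xY).
have /card_gt0P[Y YQ] : 0 < #|Q| by apply: leq_ltn_trans bigQ.
have YP : Y \in P by move: YQ; rewrite inE => /andP[].
have /set0Pn[u uY] : Y != set0 by apply: contraNneq P0 => <-.
have /set0Pn[x xX] : X != set0 by apply: contraNneq P0 => <-.
have uQ : u \in cover Q by apply/bigcupP; exists Y.
have: x \in cover Q by rewrite (connected_closedT _ _ conG uQ closedQ) inE.
case/bigcupP=> Z; rewrite inE => /andP[_ /andP[disXZ _]] xZ.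
by rewrite (disjointFr disXZ xX) in xZ.
Qed.

End Bound.

Section Singletons.
Variable G : sgraph.

Definition singletons : {set {set G}} := [set [set x] | x : G].

Lemma partition_singletons : partition singletons [set: G].
Proof.
apply/and3P; split.
- apply/eqP/setP=> x; rewrite inE; apply/bigcupP.
  by exists [set x]; rewrite ?set11 ?imset_f.
- apply/trivIsetP=> _ _ /imsetP[x _ ->] /imsetP[y _ ->] xy.
  by rewrite disjoints1 inE; apply: contra xy => /eqP->.
- by apply/imsetP=> -[x _ /setP/(_ x)]; rewrite !inE eqxx.
Qed.

Lemma card_partners_singletons (x : G) :
  #|coalition_partners singletons [set x]|
    = #|[set y | ind_coalition [set x] [set y]]|.
Proof.
rewrite -[RHS](card_imset _ set1_inj); apply: eq_card => Y; rewrite inE.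
apply/andP/imsetP=> [[/imsetP[y _ ->] cxy]|[y]].
  by exists y; rewrite ?inE.
by rewrite inE => cxy ->; rewrite imset_f.
Qed.

Lemma independent1 (x : G) : independent [set x].
Proof.
apply/forall_inP=> y /set1P->; apply/forall_inP=> z /set1P->.
by rewrite adj_irrefl.
Qed.

Lemma independent2 (x y : G) : independent [set x; y] = ~~ adj x y.
Proof.
apply/forall_inP/idP=> [ind|xy z].
  by apply: (forall_inP (ind x _)); rewrite !inE eqxx ?orbT.
by case/set2P=> ->; apply/forall_inP=> t /set2P[]->;
  rewrite ?adj_irrefl // adj_sym.
Qed.

Lemma dominating1 (x : G) :
  dominating [set x] = [forall z, (z == x) || adj z x].
Proof.
apply: eq_forallb => z; rewrite inE; congr orb.
by apply/exists_inP/idP=> [[t /set1P->]|zx] //; exists x; rewrite ?set11.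
Qed.

Lemma dominating2 (x y : G) :
  dominating [set x; y]
    = [forall z, [|| z == x, z == y, adj z x | adj z y]].
Proof.
apply: eq_forallb => z; rewrite !inE -orbA; do 2!congr orb.
apply/exists_inP/orP=> [[t /set2P[]->]|[]]; [by left | by right | |].
- by exists x; rewrite // !inE eqxx.
- by exists y; rewrite // !inE eqxx orbT.
Qed.

End Singletons.

Definition path4_adj (i j : 'I_4) : bool := (i.+1 == j) || (j.+1 == i).

Lemma path4_sym : symmetric path4_adj.
Proof. by move=> i j; rewrite /path4_adj orbC. Qed.

Lemma path4_irrefl : irreflexive path4_adj.
Proof. by move=> i; rewrite /path4_adj orbb -(addn1 i) -{2}(addn0 i) eqn_add2l. Qed.

Definition path4 : sgraph := SGraph path4_sym path4_irrefl.

Lemma connected_path4 : connected_graph path4.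
Proof.
apply/andP; split; first by rewrite card_ord.
have from0 (x : path4) : connect (@adj path4) (ord0 : 'I_4) x.
  case: x; elim=> [|n IHn] lt_n.
    by rewrite (_ : Ordinal _ = ord0) ?connect0 //; apply: val_inj.
  apply: connect_trans (IHn (ltnW lt_n)) (connect1 _).
  by rewrite /= /path4_adj eqxx.
apply/forallP=> x; apply/forallP=> y; apply: connect_trans (from0 y).
by rewrite (sym_connect_sym path4_sym); apply: from0.
Qed.

Lemma max_degree_path4 : max_degree path4 = 2.
Proof.
rewrite /max_degree; under eq_bigr => x _ do
  rewrite cardsE -sum1_card big_mkcond /= !big_ord_recl big_ord0.
by rewrite !big_ord_recl big_ord0.
Qed.

(** Turns the quantifier into a conjunction that computes. *)
Lemma forall_path4 (p : pred path4) :
  [forall z, p z] = \big[andb/true]_(z < 4) p z.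
Proof. by rewrite big_andE; apply: eq_forallb => z. Qed.

Lemma ind_coalition_path4 (x y : path4) :
  ind_coalition [set x] [set y] = (x != y) && ~~ adj x y.
Proof.
rewrite /ind_coalition /ind_dominating !independent1 independent2 /=.
rewrite !dominating1 dominating2 !forall_path4 !big_ord_recl !big_ord0.
rewrite disjoints1 inE.
by case: x => -[|[|[|[|//]]]] ?; case: y => -[|[|[|[|//]]]] ?.
Qed.

Lemma ic_partition_path4 : ic_partition (singletons path4).
Proof.
rewrite /ic_partition partition_singletons /=.
apply/forall_inP=> _ /imsetP[x _ ->]; apply/orP; right.
have [y cxy] : exists y : path4, ind_coalition [set x] [set y].
  (* Adding 2 modulo 4 moves every vertex to a nonadjacent one. *)
  exists (inord ((x + 2) %% 4) : 'I_4); rewrite ind_coalition_path4.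
  rewrite /= /path4_adj -val_eqE /= inordK ?ltn_pmod //.
  by case: x => -[|[|[|[|//]]]].
have /and5P[_ _ _ -> _] := cxy.
apply/exists_inP; exists [set y]; first exact: imset_f.
rewrite cxy andbT (inj_eq set1_inj) eq_sym.
by move: cxy; rewrite ind_coalition_path4 => /andP[].
Qed.

Lemma card_partners_path4_end :
  #|coalition_partners (singletons path4) [set (ord0 : 'I_4)]| = 2.
Proof.
rewrite card_partners_singletons -sum1_card big_mkcond.
under eq_bigr => y _ do rewrite inE ind_coalition_path4.
by rewrite !big_ord_recl big_ord0.
Qed.

Theorem theorem2p5 :
  (forall (G : sgraph) (P : {set {set G}}) (X : {set G}),
      connected_graph G -> ic_partition P -> X \in P ->
      #|coalition_partners P X| <= max_degree G)
  /\
  (exists (G : sgraph) (P : {set {set G}}) (X : {set G}),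
      [/\ connected_graph G, ic_partition P, X \in P
        & #|coalition_partners P X| = max_degree G]).
Proof.
split=> [G P X conG /andP[partP _]|]; first exact: partners_leq_max_degree.
exists path4, (singletons path4), [set (ord0 : 'I_4)]; split.
- exact: connected_path4.
- exact: ic_partition_path4.
- exact: imset_f.
- by rewrite card_partners_path4_end max_degree_path4.
Qed.
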